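(* Let $f=\frac1n\sum_{i=1}^n f_i$ with $f$ and each $f_i:\mathbb{R}^d\to\mathbb{R}$ convex and not necessarily smooth, and let $x^*$ be a minimizer of $f$. Assume interpolation, i.e. $f_i(x^* )=f_i^*:=\inf_xf_i(x)$ for every $i$. Let $G>0$ be a constant such that $\|g_i(x)\|^2<G^2$ for all $i\in\{1,\dots,n\}$, all $x\in\mathbb{R}^d$ and every subgradient $g_i(x)$ of $f_i$ at $x$. Then the iterates of the stochastic subgradient method with the subgradient counterpart of SPS with $c=1$ satisfy, for every $K\ge1$, $$\mathbb{E}\left[f(\bar{x}^K)-f(x^* )\right]\le\frac{G\|x^0-x^*\|}{\sqrt K}=O\left(\frac1{\sqrt K}\right),\qquad \bar{x}^K:=\frac1K\sum_{k=0}^{K-1}x^k.$$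
   Context: Setting: $f(x)=\frac1n\sum_{i=1}^n f_i(x)$ is minimized over $\mathbb{R}^d$, and the set of minimizers of $f$ is nonempty. Stochastic subgradient method: starting from a deterministic $x^0$, at each iteration $k$ an index $i\in\{1,\dots,n\}$ is drawn uniformly at random, independently of the past, and $x^{k+1}=x^k-\gamma_kg_i^k$, where $g_i^k=g_i(x^k)$ is a subgradient of $f_i$ at $x^k$. Subgradient counterpart of SPS with parameter $c>0$: $\gamma_k=\frac{f_i(x^k)-f_i^*}{c\|g_i^k\|^2}$, where $i$ is the index drawn at iteration $k$. If $g_i^k=0$ then $x^{k+1}=x^k$. *)

(* Defs.v *)
From HB Require Import structures.
From mathcomp Require Export all_boot all_order all_algebra.
From mathcomp Require Export all_classical all_reals all_analysis.
Export Order.TTheory GRing.Theory Num.Theory.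
Export numFieldNormedType.Exports.

Set Implicit Arguments.
Unset Strict Implicit.
Unset Printing Implicit Defensive.

Local Open Scope classical_set_scope.
Local Open Scope ring_scope.

Section euclidean_space.
Context {R : realType} {d : nat}.
Implicit Types (u v x y : 'rV[R]_d) (h : 'rV[R]_d -> R).

Definition dotp u v : R := \sum_(j < d) u 0 j * v 0 j.

(* Euclidean norm; the library norm on 'rV[R]_d is the sup norm. *)
Definition l2norm u : R := Num.sqrt (dotp u u).

Definition is_subgradient h x v : Prop :=
  forall y, h x + dotp v (y - x) <= h y.

Definition is_minimizer h x : Prop := forall y, h x <= h y.

(* Extended-real infimum: the real-valued [inf] is a junk value when h is
   unbounded below. *)
Definition inf_value h : \bar R := ereal_inf (range (fun x => (h x)%:E)).

End euclidean_space.

Section stochastic_subgradient_method.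
Context {R : realType} {d n : nat}.
Implicit Types (f : 'I_n -> 'rV[R]_d -> R) (g : 'I_n -> 'rV[R]_d -> 'rV[R]_d)
  (x : 'rV[R]_d) (i : 'I_n).

Definition finite_mean f x : R := n%:R^-1 * \sum_(i < n) f i x.

(* The use of [fine] is harmless under interpolation, where every inf_value
   (f i) is finite. *)
Definition sps_stepsize (c : R) f g i x : R :=
  (f i x - fine (inf_value (f i))) / (c * l2norm (g i x) ^+ 2).

Definition sps_step (c : R) f g i x : 'rV[R]_d :=
  if g i x == 0 then x else x - sps_stepsize c f g i x *: g i x.

(* idx k is the index drawn at iteration k. *)
Fixpoint sps_iterate (c : R) f g x0 (idx : nat -> 'I_n) (k : nat) : 'rV[R]_d :=
  if k is k'.+1 then sps_step c f g (idx k') (sps_iterate c f g x0 idx k')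
  else x0.

Definition averaged_iterate (x : nat -> 'rV[R]_d) (K : nat) : 'rV[R]_d :=
  K%:R^-1 *: \sum_(k < K) x k.

End stochastic_subgradient_method.

Section index_sampling.
Context {dT : measure_display} {T : measurableType dT} {R : realType} {n : nat}.
Implicit Types (P : probability T R) (I : nat -> T -> 'I_n).

(* The sigma-algebra generated by I 0, ..., I k.-1; as x^0 is deterministic, it
   contains all events that depend on the iterations before k. *)
Definition past I (k : nat) : set (set T) :=
  <<s [set A | exists2 j, (j < k)%N & exists B : set 'I_n, A = I j @^-1` B] >>.

Record uniform_sampling P I : Prop := UniformSampling {
  sampling_measurable :
    forall k (B : set 'I_n), measurable (I k @^-1` B) ;
  sampling_uniform :
    forall k (i : 'I_n), P (I k @^-1` [set i]) = (n%:R^-1)%:E ;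
  sampling_independent :
    forall k (A : set T) (B : set 'I_n), past I k A ->
      P (A `&` I k @^-1` B) = (P A * P (I k @^-1` B))%E
}.

End index_sampling.

(* Main.v *)
Require Import Defs.
From mathcomp Require Import ring lra.

Local Open Scope classical_set_scope.
Local Open Scope ring_scope.

(** Write [D_k] for the squared Euclidean distance from the [k]-th iterate to
    [xstar], and call [f i x - f i xstar] the gap of [f i] at [x]; under
    interpolation every gap is nonnegative. The step size is exactly the one for
    which the subgradient inequality at [xstar] gives
    [D_{k+1} <= D_k - gap ^ 2 / |g_i| ^ 2], where the gap is that of the drawn
    function at the current iterate; hence [gap ^ 2 <= G ^ 2 * (D_k - D_{k+1})]
    ([sps_step_decrease]). Telescoping and Cauchy-Schwarz bound the average of
    the first [K] drawn gaps by [G * |x0 - xstar| / sqrt K] along every sequence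
    of indices, with no probability involved ([mean_sps_gap_le]).

    Expectations enter only to replace the drawn gap at step [k] by the gap of
    the mean function: the [k]-th iterate is determined by the first [k] indices,
    and the next index is uniform and independent of them
    ([expectation_drawn_index]). Every random quantity depends on finitely many
    indices, hence takes finitely many values, so that integrability is automatic
    and integrals are finite sums. Finally, the mean function at the averaged
    iterate is at most the average of its values at the iterates, by the
    subgradient inequality at the averaged iterate ([le_average_subgradient]). *)

(** * Euclidean geometry and subgradients *)

Section euclidean_geometry.
Context {R : realType} {d : nat}.
Implicit Types (u v x y : 'rV[R]_d) (h : 'rV[R]_d -> R).

Lemma dotpC u v : dotp u v = dotp v u.
Proof. by apply: eq_bigr => j _; rewrite mulrC. Qed.

Lemma dotpDl u v y : dotp (u + v) y = dotp u y + dotp v y.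
Proof. by rewrite -big_split; apply: eq_bigr => j _ /=; rewrite mxE mulrDl. Qed.

Lemma dotpZl (a : R) u v : dotp (a *: u) v = a * dotp u v.
Proof. by rewrite /dotp mulr_sumr; apply: eq_bigr => j _; rewrite mxE mulrA. Qed.

Lemma dotpNl u v : dotp (- u) v = - dotp u v.
Proof. by rewrite -scaleN1r dotpZl mulN1r. Qed.

Lemma dotp_suml (J : finType) (F : J -> 'rV[R]_d) v :
  dotp (\sum_j F j) v = \sum_j dotp (F j) v.
Proof.
rewrite /dotp exchange_big; apply: eq_bigr => j _ /=.
by rewrite summxE mulr_suml.
Qed.

Lemma l2norm_sqr u : l2norm u ^+ 2 = dotp u u.
Proof. by rewrite sqr_sqrtr// sumr_ge0// => j _; rewrite -expr2 sqr_ge0. Qed.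

Lemma l2norm_sqr_gt0 u : u != 0 -> 0 < l2norm u ^+ 2.
Proof.
move=> u0; rewrite lt_neqAle sqr_ge0 andbT eq_sym l2norm_sqr.
apply: contra_neq u0 => uu0; apply/rowP => j; rewrite mxE; apply/eqP.
have /psumr_eq0P/(_ uu0 j isT)/eqP : forall j, true -> 0 <= u 0 j * u 0 j.
  by move=> i _; rewrite -expr2 sqr_ge0.
by rewrite mulf_eq0 orbb.
Qed.

Lemma l2norm_sqr_subZ u v (a : R) :
  l2norm (u - a *: v) ^+ 2
    = l2norm u ^+ 2 - 2 * a * dotp v u + a ^+ 2 * l2norm v ^+ 2.
Proof.
rewrite !l2norm_sqr !(dotpDl, dotpNl, dotpZl).
rewrite (dotpC u) (dotpC v (_ - _)) !(dotpDl, dotpNl, dotpZl) (dotpC u v).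
ring.
Qed.

(** Jensen's inequality for an average, from one subgradient at the average. *)
Lemma le_average_subgradient h (x : nat -> 'rV[R]_d) K v : (0 < K)%N ->
  is_subgradient h (averaged_iterate x K) v ->
  h (averaged_iterate x K) <= K%:R^-1 * \sum_(k < K) h (x k).
Proof.
move=> K0 hv; set xbar := averaged_iterate x K in hv *.
have K0' : (K%:R : R) != 0 by rewrite pnatr_eq0 -lt0n.
(* The deviations from the average sum to zero. *)
have v_sum0 : \sum_(k < K) dotp v (x k - xbar) = 0.
  under eq_bigr do rewrite dotpC.
  rewrite -dotp_suml sumrB sumr_const card_ord -scaler_nat scalerA divff//.
  by rewrite scale1r subrr -(scale0r 0) dotpZl mul0r.
rewrite mulrC ler_pdivlMr ?ltr0n//.
have -> : h xbar * K%:R = \sum_(k < K) (h xbar + dotp v (x k - xbar)).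
  by rewrite big_split /= v_sum0 addr0 sumr_const card_ord mulr_natr.
by apply: ler_sum => k _; apply: hv.
Qed.

Lemma finite_mean_subgradient n (f : 'I_n -> 'rV[R]_d -> R)
    (v : 'I_n -> 'rV[R]_d) x :
  (forall i, is_subgradient (f i) x (v i)) ->
  is_subgradient (finite_mean f) x (n%:R^-1 *: \sum_(i < n) v i).
Proof.
move=> fv y; rewrite dotpZl dotp_suml -mulrDr -big_split /=.
by rewrite ler_wpM2l ?invr_ge0// ler_sum// => i _; apply: fv.
Qed.

End euclidean_geometry.

(** The Cauchy-Schwarz inequality against the constant vector 1, from the
    nonnegativity of the variance. *)
Lemma sum_sqr_le (R : realFieldType) (K : nat) (a : 'I_K -> R) : (0 < K)%N ->
  (\sum_k a k) ^+ 2 <= K%:R * \sum_k a k ^+ 2.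
Proof.
move=> K0; have K0' : 0 < K%:R :> R by rewrite ltr0n.
set S := \sum_k a k; set m := S / K%:R.
have Sm : S = m * K%:R by rewrite mulfVK// gt_eqF.
have : 0 <= \sum_k (a k - m) ^+ 2 by apply: sumr_ge0 => k _; rewrite sqr_ge0.
have -> : \sum_k (a k - m) ^+ 2 = \sum_k a k ^+ 2 - m ^+ 2 * K%:R.
  under eq_bigr do rewrite sqrrB.
  rewrite big_split sumrB sumr_const card_ord /= -mulr_natr.
  under [X in _ - X + _]eq_bigr do rewrite -mulr_natr -mulrA mulrC.
  by rewrite -mulr_sumr -/S Sm; ring.
by move=> h; rewrite Sm -subr_ge0; nra.
Qed.

(** * The method along a fixed sequence of indices *)

Section sps_path.
Context {R : realType} {d n : nat}.
Variables (f : 'I_n -> 'rV[R]_d -> R) (g : 'I_n -> 'rV[R]_d -> 'rV[R]_d).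
Variables (xstar x0 : 'rV[R]_d) (G : R).
Hypothesis interpolation : forall i, (f i xstar)%:E = inf_value (f i).
Hypothesis g_subgradient : forall i x, is_subgradient (f i) x (g i x).
Hypothesis g_bound : forall i x, l2norm (g i x) ^+ 2 < G ^+ 2.

Lemma interpolation_min i : is_minimizer (f i) xstar.
Proof.
by move=> x; rewrite -lee_fin interpolation; apply: ereal_inf_lbound; exists x.
Qed.

(** One step with index [i] pays for the squared gap of [f i] by a decrease of
    the squared distance to [xstar]. *)
Lemma sps_step_decrease i x :
  (f i x - f i xstar) ^+ 2 <=
  G ^+ 2 * (l2norm (x - xstar) ^+ 2 - l2norm (sps_step 1 f g i x - xstar) ^+ 2).
Proof.
have fmin := interpolation_min i x; have := g_subgradient i x xstar.
rewrite /sps_step; case: eqVneq => [->|g0].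
  (* A zero subgradient means that x minimizes f i, so the gap vanishes. *)
  rewrite -(scale0r 0) dotpZl mul0r addr0 => fx.
  have -> : f i x = f i xstar by apply/eqP; rewrite eq_le fx fmin.
  by rewrite !subrr expr0n mulr0.
rewrite -opprB dotpC dotpNl dotpC => gx.
rewrite addrAC l2norm_sqr_subZ /sps_stepsize -interpolation/= mul1r.
have := g_bound i x; have := l2norm_sqr_gt0 _ g0.
set s := l2norm (g i x) ^+ 2; set b := f i x - f i xstar => s0 sG.
set p := dotp _ _ in gx *.
have b0 : 0 <= b by rewrite subr_ge0.
have bp : b <= p by rewrite /b; lra.
rewrite -addrA opprD addrA subrr add0r opprD opprK.
have -> : 2 * (b / s) * p - (b / s) ^+ 2 * s = (b * p * 2 - b ^+ 2) / s.
  by field; rewrite gt_eqF.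
rewrite mulrA ler_pdivlMr//.
have bs : b ^+ 2 * s <= b ^+ 2 * G ^+ 2 by rewrite ler_wpM2l ?sqr_ge0// ltW.
have bG : 0 <= G ^+ 2 * (b * (p - b)).
  by apply: mulr_ge0 (sqr_ge0 _) (mulr_ge0 b0 _); rewrite subr_ge0.
by apply: le_trans bs _; lra.
Qed.

Let x (idx : nat -> 'I_n) k := sps_iterate 1 f g x0 idx k.

Lemma sum_sps_gap_sqr (idx : nat -> 'I_n) K :
  \sum_(k < K) (f (idx k) (x idx k) - f (idx k) xstar) ^+ 2 <=
  G ^+ 2 * l2norm (x0 - xstar) ^+ 2.
Proof.
suff : \sum_(k < K) (f (idx k) (x idx k) - f (idx k) xstar) ^+ 2 <=
  G ^+ 2 * (l2norm (x0 - xstar) ^+ 2 - l2norm (x idx K - xstar) ^+ 2).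
  move=> /le_trans; apply; rewrite ler_wpM2l ?sqr_ge0//.
  by rewrite lerBlDr lerDl sqr_ge0.
elim: K => [|K IH]; first by rewrite big_ord0 subrr mulr0.
rewrite big_ord_recr /=; have := sps_step_decrease (idx K) (x idx K).
by rewrite -/(x idx K); lra.
Qed.

Lemma mean_sps_gap_le (idx : nat -> 'I_n) K : (0 < K)%N -> 0 <= G ->
  K%:R^-1 * (\sum_(k < K) (f (idx k) (x idx k) - f (idx k) xstar)) <=
  G * l2norm (x0 - xstar) / Num.sqrt K%:R.
Proof.
move=> K0 G0; have K0' : 0 < K%:R :> R by rewrite ltr0n.
have sK0 : 0 < Num.sqrt K%:R :> R by rewrite sqrtr_gt0.
rewrite mulrC ler_pdivrMr// -{2}(sqr_sqrtr (ltW K0')) expr2 mulrA divfK ?gt_eqF//.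
have rhs0 : 0 <= G * l2norm (x0 - xstar) * Num.sqrt K%:R.
  by rewrite !mulr_ge0 ?sqrtr_ge0.
rewrite -(@ler_pXn2r _ 2%N) ?nnegrE//; last first.
  by apply: sumr_ge0 => k _; rewrite subr_ge0 interpolation_min.
apply: le_trans (sum_sqr_le _ _ _ K0) _.
rewrite exprMn (sqr_sqrtr (ltW K0')) mulrC.
by rewrite ler_wpM2r ?(ltW K0')// exprMn sum_sps_gap_sqr.
Qed.

End sps_path.

(** * Dependence on finitely many indices *)

(** [Phi], a function of an infinite sequence of indices, depends only on the
    first [k] of them. *)
Definition prefix_determined {n : nat} {V : Type} (k : nat)
    (Phi : (nat -> 'I_n) -> V) : Prop :=
  forall idx idx', (forall j, (j < k)%N -> idx j = idx' j) -> Phi idx = Phi idx'.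

Lemma sps_iterate_prefix_determined (R : realType) d n (c : R)
    (f : 'I_n -> 'rV[R]_d -> R) g x0 k K : (k <= K)%N ->
  prefix_determined K (fun idx => sps_iterate c f g x0 idx k).
Proof.
move=> kK idx idx' eqi; elim: k kK => //= k IH kK.
by rewrite IH ?(ltnW kK)// eqi.
Qed.

(** * Integrals of finitely valued random variables *)

Section finitely_valued_expectation.
Context {dT : measure_display} {T : measurableType dT} {R : realType}.
Variables (P : probability T R) (J : finType) (H : T -> J).
Hypothesis measurable_H : forall j, measurable (H @^-1` [set j]).

Let fiber_sum (phi : J -> R) :
  (fun w => (phi (H w))%:E) =
  (fun w => \sum_(j : J) (phi j)%:E * (\1_(H @^-1` [set j]) w)%:E)%E.
Proof.
apply/funext => w; rewrite (bigD1 (H w))//= big1 => [|j jH].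
  by rewrite adde0 indicE mem_set// mule1.
rewrite indicE memNset ?mule0//= => /esym jE.
by rewrite jE eqxx in jH.
Qed.

Let fiber_integrable (phi : J -> R) j :
  P.-integrable setT (fun w => (phi j)%:E * (\1_(H @^-1` [set j]) w)%:E)%E.
Proof. by apply: integrableZl => //; apply: integrable_indic. Qed.

Lemma finitely_valued_integrable (phi : J -> R) :
  P.-integrable setT (fun w => (phi (H w))%:E).
Proof. by rewrite fiber_sum; apply: integrable_sum. Qed.

Lemma finitely_valued_integral (phi : J -> R) :
  (\int[P]_w (phi (H w))%:E = \sum_j (phi j)%:E * P (H @^-1` [set j]))%E.
Proof.
rewrite fiber_sum integral_sum//; apply: eq_bigr => j _.
rewrite integralZl//; last exact: integrable_indic.
by rewrite integral_indic// setIT.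
Qed.

End finitely_valued_expectation.

(** * Uniform sampling of the indices *)

Section uniform_index_sampling.
Context {dT : measure_display} {T : measurableType dT} {R : realType} {n : nat}.
Variables (P : probability T R) (I : nat -> T -> 'I_n) (i0 : 'I_n).
Hypothesis I_sampling : uniform_sampling P I.

Let path w : nat -> 'I_n := fun j => I j w.

(** The tuple of the first [k] drawn indices, a random variable with values in
    a finite type. *)
Definition history (k : nat) (w : T) : {ffun 'I_k -> 'I_n} :=
  [ffun j => I (val j) w].

(** The infinite sequence that starts with [a] and then repeats the dummy index
    [i0]. *)
Definition extend_history (k : nat) (a : {ffun 'I_k -> 'I_n}) : nat -> 'I_n :=
  fun j => if insub j is Some j' then a j' else i0.

Lemma prefix_determined_history {V : Type} k (Phi : (nat -> 'I_n) -> V) w :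
  prefix_determined k Phi -> Phi (path w) = Phi (extend_history _ (history k w)).
Proof.
move=> Phik; apply: Phik => j jk.
by rewrite /extend_history insubT ffunE.
Qed.

Lemma past_history k (a : {ffun 'I_k -> 'I_n}) : past I k (history k @^-1` [set a]).
Proof.
have -> : history k @^-1` [set a] = \bigcap_(j in [set: 'I_k]) (I j @^-1` [set a j]).
  apply/seteqP; split => w /= => [<- j _|wa]; first by rewrite /= ffunE.
  by apply/ffunP => j; rewrite ffunE; apply: wa.
apply: (@fin_bigcap_measurable _ (g_sigma_algebraType _)) => // j _.
apply: sub_sigma_algebra; exists (val j); first exact: ltn_ord.
by exists [set a j].
Qed.

Lemma past_measurable k : past I k `<=` dT.-measurable.
Proof.
apply: smallest_sub; first exact: sigma_algebra_measurable.
by move=> _ [j _ [B ->]]; exact: (sampling_measurable I_sampling).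
Qed.

Lemma measurable_history k a : measurable (history k @^-1` [set a]).
Proof. by apply: (@past_measurable k); apply: past_history. Qed.

Lemma prefix_determined_integrable k (Phi : (nat -> 'I_n) -> R) :
  prefix_determined k Phi ->
  P.-integrable setT (fun w => (Phi (path w))%:E).
Proof.
move=> Phik; under eq_fun do rewrite (prefix_determined_history _ _ _ Phik).
apply: (finitely_valued_integrable _ _ (history k) _ (Phi \o extend_history k)).
exact: measurable_history.
Qed.

(** If every [Phi i] depends only on the first [k] indices, then integrating
    [Phi] at the index drawn at step [k] amounts to averaging over all indices:
    the event of a given history belongs to the past, of which [I k] is
    independent. *)
Lemma expectation_drawn_index k (Phi : 'I_n -> (nat -> 'I_n) -> R) :
  (forall i, prefix_determined k (Phi i)) ->
  (\int[P]_w (Phi (I k w) (path w))%:E =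
   \int[P]_w (n%:R^-1 * \sum_(i < n) Phi i (path w))%:E)%E.
Proof.
move=> Phik.
pose H w := (history k w, I k w).
have HE a i : H @^-1` [set (a, i)] = history k @^-1` [set a] `&` I k @^-1` [set i].
  by apply/seteqP; split => w /= => [[-> ->]|[<- <-]].
have mH p : measurable (H @^-1` [set p]).
  case: p => a i; rewrite HE; apply: measurableI; first exact: measurable_history.
  exact: (sampling_measurable I_sampling).
under eq_integral do rewrite (prefix_determined_history _ _ _ (Phik _)).
rewrite (finitely_valued_integral _ _ _ mH (fun p => Phi p.2 (extend_history _ p.1))).
under [RHS]eq_integral => w _.
  under eq_bigr do rewrite (prefix_determined_history _ _ w (Phik _)).
  over.
rewrite (finitely_valued_integral _ _ _ (measurable_history k)
  (fun a => n%:R^-1 * \sum_(i < n) Phi i (extend_history _ a))).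
transitivity (\sum_a \sum_i (Phi i (extend_history k a))%:E
    * P (H @^-1` [set (a, i)]))%E.
  by rewrite pair_bigA; apply: eq_bigr => -[a i] _.
apply: eq_bigr => a _.
have PA : P (history k @^-1` [set a]) \is a fin_num.
  by apply: fin_num_measure; apply: measurable_history.
under eq_bigr => i _.
  rewrite HE (sampling_independent I_sampling _ (past_history _ a)).
  rewrite (sampling_uniform I_sampling) -(fineK PA) -!EFinM.
  over.
rewrite -(fineK PA) -EFinM sumEFin; congr (_%:E).
by rewrite -mulr_suml; ring.
Qed.

End uniform_index_sampling.

Theorem theoremC1 (R : realType) (d n : nat) (hn : (0 < n)%N)
    (f : 'I_n -> 'rV[R]_d -> R)
    (f_convex : forall i : 'I_n, convex_function [set: 'rV[R]_d] (f i))
    (mean_convex : convex_function [set: 'rV[R]_d] (finite_mean f))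
    (xstar : 'rV[R]_d) (xstar_min : is_minimizer (finite_mean f) xstar)
    (interpolation : forall i : 'I_n, (f i xstar)%:E = inf_value (f i))
    (G : R) (G_gt0 : 0 < G)
    (subgradient_bound : forall (i : 'I_n) (x v : 'rV[R]_d),
      is_subgradient (f i) x v -> l2norm v ^+ 2 < G ^+ 2)
    (g : 'I_n -> 'rV[R]_d -> 'rV[R]_d)
    (g_subgradient : forall (i : 'I_n) (x : 'rV[R]_d),
      is_subgradient (f i) x (g i x))
    (x0 : 'rV[R]_d)
    (dT : measure_display) (T : measurableType dT) (P : probability T R)
    (I : nat -> T -> 'I_n) (I_sampling : uniform_sampling P I) :
  let x (k : nat) (w : T) := sps_iterate 1 f g x0 (fun j => I j w) k in
  let xbar (K : nat) (w : T) := averaged_iterate (fun k => x k w) K in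
  let bound (K : nat) : R := G * l2norm (x0 - xstar) / Num.sqrt K%:R in
  (forall K : nat, (1 <= K)%N ->
    ('E_P[(fun w => finite_mean f (xbar K w) - finite_mean f xstar)%R]
       <= (bound K)%:E)%E)
  /\ (bound : nat -> R^o) =O_\oo (fun K : nat => 1 / Num.sqrt K%:R : R^o).
Proof.
move=> x xbar bound; split; last first.
  (* The + 1 keeps the constant positive when x0 = xstar. *)
  apply/eqO_exP; exists (G * l2norm (x0 - xstar) + 1).
    by rewrite ltr_wpDl// mulr_ge0 ?sqrtr_ge0// ltW.
  apply: nearW => K; rewrite /bound mul1r normrM ler_wpM2r//.
  by rewrite ger0_norm ?lerDl// mulr_ge0 ?sqrtr_ge0// ltW.
move=> K K0; pose i0 := Ordinal hn.
have gG i y : l2norm (g i y) ^+ 2 < G ^+ 2.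
  by apply: subgradient_bound (g_subgradient i y).
pose X k idx := sps_iterate 1 f g x0 idx k.
have Xpre k k' : (k <= k')%N -> prefix_determined k' (X k).
  exact: sps_iterate_prefix_determined.
pose gap i y := f i y - f i xstar.
have mean_gap y :
    finite_mean f y - finite_mean f xstar = n%:R^-1 * \sum_(i < n) gap i y.
  by rewrite /finite_mean -mulrBr -sumrB.
pose path w := fun j => I j w.
have int_path k (Phi : (nat -> 'I_n) -> R) : prefix_determined k Phi ->
    P.-integrable setT (fun w => (Phi (path w))%:E).
  exact: prefix_determined_integrable.
have int_mean k :
    P.-integrable setT (fun w => (n%:R^-1 * \sum_(i < n) gap i (X k (path w)))%:E).
  apply: (int_path k (fun idx => n%:R^-1 * \sum_(i < n) gap i (X k idx))) => idx idx' eqi.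
  by rewrite (Xpre k k (leqnn k) idx idx').
have int_drawn k : P.-integrable setT (fun w => (gap (I k w) (X k (path w)))%:E).
  apply: (int_path k.+1 (fun idx => gap (idx k) (X k idx))) => idx idx' eqi.
  by rewrite (Xpre k k.+1 (leqnSn k) idx idx')// eqi.
have drawn_mean k : (\int[P]_w (gap (I k w) (X k (path w)))%:E =
    \int[P]_w (n%:R^-1 * \sum_(i < n) gap i (X k (path w)))%:E)%E.
  apply: (expectation_drawn_index _ _ i0 I_sampling _ (fun i idx => gap i (X k idx))).
  by move=> i idx idx' eqi; rewrite (Xpre k k (leqnn k) idx idx').
have scale_sum (F : nat -> T -> R) :
    (forall k, P.-integrable setT (fun w => (F k w)%:E)) ->
    P.-integrable setT (fun w => (K%:R^-1 * \sum_(k < K) F k w)%:E) /\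
    (\int[P]_w (K%:R^-1 * \sum_(k < K) F k w)%:E =
     K%:R^-1%:E * \sum_(k < K) \int[P]_w (F k w)%:E)%E.
  move=> intF; under eq_fun do rewrite EFinM -sumEFin.
  have intS : P.-integrable setT (fun w => (\sum_(k < K) (F k w)%:E)%R).
    by apply: integrable_sum.
  split; first exact: integrableZl.
  rewrite integralZl//; congr (_ * _)%E.
  exact: (integral_sum _ (fun k : 'I_K => intF k)).
have [int_means means_eq] := scale_sum _ int_mean.
have [int_drawns drawns_eq] := scale_sum _ int_drawn.
rewrite expectation.unlock.
apply: (@le_trans _ _ (\int[P]_w
    (K%:R^-1 * \sum_(k < K) (n%:R^-1 * \sum_(i < n) gap i (X k (path w))))%:E)%E).
  apply: le_integral => //.
    apply: (int_path K (fun idx =>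
      finite_mean f (averaged_iterate (fun k => X k idx) K) - finite_mean f xstar)).
    move=> idx idx' eqi; congr (finite_mean f (_ *: _) - _).
    by apply: eq_bigr => k _; apply: (Xpre k K (ltnW (ltn_ord k))).
  move=> w _; rewrite lee_fin.
  under [X in _ <= _ * X]eq_bigr do rewrite -mean_gap.
  have h := le_average_subgradient _ _ _ _ K0
    (finite_mean_subgradient _ _ _ _ (fun i => g_subgradient i (xbar K w))).
  rewrite sumrB sumr_const card_ord -(mulr_natl (finite_mean f xstar)) mulrBr.
  rewrite mulKf; last by rewrite pnatr_eq0 -lt0n.
  exact: lerB.
rewrite means_eq.
under eq_bigr do rewrite -drawn_mean.
rewrite -drawns_eq.
rewrite -(expectation_cst P (bound K)) expectation.unlock.
apply: le_integral => //; first exact: finite_measure_integrable_cst.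
move=> w _; rewrite lee_fin.
exact: (mean_sps_gap_le _ _ _ x0 _ interpolation g_subgradient gG (path w) _ K0
  (ltW G_gt0)).
Qed.
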